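(* There is a proper Zariski closed subset $C\subsetneq\mathbb{R}^5$ such that for every $(\gamma_1,\dots,\gamma_5)\in\mathbb{R}^5\setminus C$ the number of cross configurations of the six-vortex problem (CC6VP) with vortex strengths $\gamma_1,\gamma_2,\gamma_3,\gamma_4,\gamma_5,\gamma_6$, where $\gamma_6=\gamma_5$, counted modulo translations, rotations and dilations of the plane, is finite.
   Context: Let $x=(x_1,\dots,x_6)\in(\mathbb{R}^2)^6$ with $x_i\ne x_j$ for $i\neq j$, put $r_{ij}=\|x_i-x_j\|$, let $\gamma_1,\dots,\gamma_6$ be nonzero real vortex strengths with $\gamma=\gamma_1+\cdots+\gamma_6\ne0$, and let $c=\frac1\gamma(\gamma_1x_1+\cdots+\gamma_6x_6)$. The configuration $x$ is a central configuration of the six-vortex problem if there is $\lambda\neq0$ with $\sum_{j\ne i}\gamma_j(x_j-x_i)r_{ij}^{-2}+\lambda(x_i-c)=0$ for $i=1,\dots,6$. A CC6VP (cross configuration of the six-vortex problem) is a planar (non-collinear) central configuration of the six-vortex problem such that the set $\{x_1,\dots,x_6\}$ is symmetric with respect to a line $s$ containing exactly four of the six points. The bodies are indexed so that $x_1,x_2,x_3,x_4\in s$; then $x_5,x_6$ are mirror images of each other in $s$. (For such a configuration one always has $\gamma_5=\gamma_6$.) Configurations are counted modulo translations, rotations and dilations. A Zariski closed subset of $\mathbb{R}^5$ is the common zero set of a family of real polynomials in five variables. *)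

(* Defs.v *)
From mathcomp Require Import all_boot all_order all_algebra.
From mathcomp Require Import boolp classical_sets cardinality reals.
From mathcomp Require Import mpoly.

Set Implicit Arguments.
Unset Strict Implicit.
Unset Printing Implicit Defensive.

Import Order.TTheory GRing.Theory Num.Theory.
Local Open Scope classical_set_scope.
Local Open Scope ring_scope.

Notation plane R := 'rV[R]_2.

(* The body x_(k+1) is [x i] with [i : 'I_6] of value k; thus x_1, ..., x_4
   are the [x i] with [i < 4], and x_5, x_6 are those with [i] = 4, 5. *)
Notation config R := ('I_6 -> plane R).

Section PlaneGeometry.
Variable R : realType.
Implicit Types (u v p d : plane R) (x y : config R).

Definition dot u v : R := \sum_(k < 2) u 0 k * v 0 k.

Definition euclid_norm u : R := Num.sqrt (dot u u).

Definition line p d : set (plane R) := [set p + t *: d | t in [set: R]].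

(* Orthogonal reflection in [line p d], for [d != 0]. *)
Definition reflection p d u : plane R :=
  p + (2 * (dot (u - p) d / dot d d)) *: d - (u - p).

Definition collinear x : Prop :=
  exists p d, d != 0 /\ forall i, line p d (x i).

(* Rotations act on row vectors from the right. *)
Definition is_rotation (Q : 'M[R]_2) : Prop := Q *m Q^T = 1%:M /\ \det Q = 1.

Definition equiv_config x y : Prop :=
  exists (k : R) (Q : 'M[R]_2) (t : plane R),
    [/\ 0 < k, is_rotation Q & forall i, y i = k *: (x i *m Q) + t].

End PlaneGeometry.

Section SixVortex.
Variable R : realType.
Implicit Types (gamma : 'I_6 -> R) (x : config R).

Definition vortex_center gamma x : plane R :=
  (\sum_i gamma i)^-1 *: \sum_i gamma i *: x i.

(* The standing assumptions on the strengths and on the positions are part of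
   the definition: for excluded strengths there is no central configuration. *)
Definition central_configuration gamma x : Prop :=
  [/\ forall i, gamma i != 0,
      \sum_i gamma i != 0,
      injective x &
      exists2 lambda : R, lambda != 0 &
        forall i,
          \sum_(j | j != i)
             (gamma j * euclid_norm (x i - x j) ^- 2) *: (x j - x i)
          + lambda *: (x i - vortex_center gamma x) = 0].

Definition CC6VP gamma : set (config R) :=
  [set x | [/\ central_configuration gamma x,
               ~ collinear x &
               exists p d : plane R,
                 [/\ d != 0,
                     reflection p d @` range x = range x &
                     forall i, line p d (x i) <-> (i < 4)%N]]].

(* gamma_1, ..., gamma_5 extended by gamma_6 := gamma_5. *)
Definition extend_strengths (g : 'I_5 -> R) (i : 'I_6) : R :=
  if unlift ord_max i is Some j then g j else g ord_max.

End SixVortex.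

Definition zariski_closed (R : realType) (n : nat) (C : set ('I_n -> R)) : Prop :=
  exists S : set {mpoly R[n]}, C = [set v | forall p, S p -> p.@[v] = 0].

(* Main.v *)
Require Import Defs.
From mathcomp Require Import all_boot all_order all_algebra.
From mathcomp Require Import boolp classical_sets cardinality reals.
From mathcomp Require Import mpoly.
From mathcomp Require Import ring lra zify.

(** Placing the two mirror bodies at [(0, 1)] and [(0, -1)] and the others at
    [(t_i, 0)], the equations of a cross configuration, once the multiplier and
    the centre are eliminated, become four equations in [t_1, ..., t_4] that are
    linear and homogeneous in the five strengths. Where [k] of the positions form
    a transcendence basis of all four, the [k] corresponding equations are
    independent, since one [k x k] minor is a nonzero polynomial in those [k]
    positions. So [k] strengths are rational in the positions and the [5 - k]
    other strengths, and the solution set has dimension at most [k + (5 - k) = 5].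
    Hence [t_i] and the five strengths are algebraically dependent, by a relation
    [P_i (t_i, g) = 0]; where the leading coefficients [c_i (g)] do not vanish,
    each [t_i] is a root of a nonzero polynomial. Dimension is measured by the
    growth of the spaces of polynomial functions of bounded degree on a set. *)

Set Implicit Arguments.
Unset Strict Implicit.
Unset Printing Implicit Defensive.

Import Order.TTheory GRing.Theory Num.Theory.
Local Open Scope classical_set_scope.
Local Open Scope ring_scope.

(** * Growth of spaces of polynomial functions *)

Section Growth.
Variables (R : fieldType) (X : Type).
Implicit Types (V W : set X) (G H : set (X -> R)) (f h : X -> R).

(** Polynomials in finitely many members of [G]. The index is only an upper bound for the degree, so
    that sums need no maximum. *)
Inductive poly_deg G : nat -> (X -> R) -> Prop :=
| poly_deg_cst n c : poly_deg G n (fun=> c)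
| poly_deg_gen n f : G f -> poly_deg G n.+1 f
| poly_deg_add n f h :
    poly_deg G n f -> poly_deg G n h -> poly_deg G n (fun x => f x + h x)
| poly_deg_mul m n f h :
    poly_deg G m f -> poly_deg G n h ->
    poly_deg G (m + n)%N (fun x => f x * h x).

Lemma poly_deg_le G m n f : (m <= n)%N -> poly_deg G m f -> poly_deg G n f.
Proof.
move=> /subnKC <- Gf.
rewrite (_ : f = fun x => f x * 1); last by apply: funext => x; rewrite mulr1.
exact: poly_deg_mul Gf (poly_deg_cst _ _ _).
Qed.

Lemma poly_deg_sub G H n f : G `<=` H -> poly_deg G n f -> poly_deg H n f.
Proof.
move=> GH; elim=> {n f}.
- by move=> n c; exact: poly_deg_cst.
- by move=> n f /GH; exact: poly_deg_gen.
- by move=> n f h _ ? _ ?; exact: poly_deg_add.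
- by move=> m n f h _ ? _ ?; exact: poly_deg_mul.
Qed.

Lemma poly_deg_sum G n (I : Type) (s : seq I) (F : I -> X -> R) :
  (forall i, poly_deg G n (F i)) ->
  poly_deg G n (fun x => \sum_(i <- s) F i x).
Proof.
move=> GF; elim: s => [|i s IHs].
  by rewrite (_ : (fun _ => _) = fun=> 0);
    [exact: poly_deg_cst | apply: funext => x; rewrite big_nil].
rewrite (_ : (fun _ => _) = fun x => F i x + \sum_(j <- s) F j x).
  exact: poly_deg_add.
by apply: funext => x; rewrite big_cons.
Qed.

Lemma poly_deg_exp G n k f :
  poly_deg G n f -> poly_deg G (k * n)%N (fun x => f x ^+ k).
Proof.
move=> Gf; elim: k => [|k IHk].
  by rewrite (_ : (fun _ => _) = fun=> 1);
    [exact: poly_deg_cst | apply: funext => x; rewrite expr0].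
rewrite mulSn (_ : (fun _ => _) = fun x => f x * f x ^+ k).
  exact: poly_deg_mul.
by apply: funext => x; rewrite exprS.
Qed.

(** The spanning functions need not belong to [S]; [growth_alg] uses this to span polynomials by
    fractions. *)
Definition spanned V (N : nat) (S : set (X -> R)) :=
  exists (I : finType) (b : I -> X -> R), (#|I| <= N)%N /\
    forall f, S f ->
      exists c : I -> R, forall x, V x -> f x = \sum_i c i * b i x.

(** A bound of Hilbert function type: growth of order [r] stands for dimension at most [r]. *)
Definition growth V G (r : nat) :=
  exists K, forall D, spanned V (K * D.+1 ^ r) (poly_deg G D).

Lemma growth_subset V W G H r :
  W `<=` V -> H `<=` G -> growth V G r -> growth W H r.
Proof.
move=> WV HG [K gr]; exists K => D; have [I [b [cI bP]]] := gr D.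
exists I, b; split=> // f Hf; have [c cE] := bP f (poly_deg_sub HG Hf).
by exists c => x /WV; exact: cE.
Qed.

Lemma growth0 V : growth V set0 0.
Proof.
exists 1%N => D; exists unit, (fun _ _ => 1); split.
  by rewrite card_unit mul1n expn0.
move=> f Df; suff [c fE] : exists c, f = fun=> c.
  by exists (fun=> c) => x _; rewrite fE big_const card_unit /= mulr1 addr0.
elim: Df => {f D} [_ c|//|n f h _ [c ->] _ [d ->]|m n f h _ [c ->] _ [d ->]].
- by exists c.
- by exists (c + d).
- by exists (c * d).
Qed.

(** Polynomials are sorted by powers of [h]. The bound [D] on every coefficient is crude, but this
    does not affect the order of growth. *)
Lemma poly_deg_decomp G h D f :
  poly_deg (h |` G) D f ->
  exists p : X -> {poly R},
    [/\ forall x, (size (p x) <= D.+1)%N,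
        forall k, poly_deg G D (fun x => (p x)`_k) &
        forall x, f x = (p x).[h x]].
Proof.
elim=> {D f}.
- move=> n c; exists (fun=> c%:P); split=> [x|k|x].
  + by rewrite (leq_trans (size_polyC_leq1 _)).
  + by under eq_fun do rewrite coefC; exact: poly_deg_cst.
  + by rewrite hornerC.
- move=> n f [->|Gf].
    exists (fun=> 'X); split=> [x|k|x]; first by rewrite size_polyX.
      by under eq_fun do rewrite coefX; exact: poly_deg_cst.
    by rewrite hornerX.
  exists (fun x => (f x)%:P); split=> [x|k|x].
  + by rewrite (leq_trans (size_polyC_leq1 _)).
  + under eq_fun do rewrite coefC; case: eqP => _; last exact: poly_deg_cst.
    exact: poly_deg_gen.
  + by rewrite hornerC.
- move=> n f g _ [p [sp Gp fE]] _ [q [sq Gq gE]].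
  exists (fun x => p x + q x); split=> [x|k|x].
  + by rewrite (leq_trans (size_polyD _ _))// geq_max sp sq.
  + by under eq_fun do rewrite coefD; exact: poly_deg_add.
  + by rewrite hornerD fE gE.
- move=> m n f g _ [p [sp Gp fE]] _ [q [sq Gq gE]].
  exists (fun x => p x * q x); split=> [x|k|x].
  + rewrite (leq_trans (size_polyMleq _ _))//.
    by have := sp x; have := sq x; lia.
  + under eq_fun do rewrite coefM.
    by apply: poly_deg_sum => i; exact: poly_deg_mul.
  + by rewrite hornerM fE gE.
Qed.

(** Exponents of [h] run from 0 to [D], which multiplies the number of spanning functions by
    [D.+1]. *)
Lemma growth_free V G h r : growth V G r -> growth V (h |` G) r.+1.
Proof.
move=> [K gr]; exists K => D; have [I [b [cI bP]]] := gr D.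
exists ('I_D.+1 * I)%type, (fun (ki : 'I_D.+1 * I) x => b ki.2 x * h x ^+ ki.1); split.
  by rewrite card_prod card_ord expnS mulnCA leq_mul2l cI orbT.
move=> f /poly_deg_decomp[p [sp Gp fE]].
have /choice[c cE] k := bP _ (Gp k).
exists (fun ki : 'I_D.+1 * I => c ki.1 ki.2) => x Vx.
rewrite fE (horner_coef_wide _ (sp x)) -(pair_bigA _ (fun k i =>
  c (nat_of_ord k) i * (b i x * h x ^+ k))) /=.
apply: eq_bigr => k _; rewrite cE// big_distrl/=.
by apply: eq_bigr => i _; rewrite mulrA.
Qed.

(* Multiplying by [q x ^+ j] lets the relation reduce [h x ^+ j] to exponents at
   most [m], at the price of coefficients whose degree is linear in [j]. *)
Lemma reduce_power V G h q m (a : nat -> X -> R) e :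
  poly_deg G e q -> (forall k, poly_deg G e (a k)) ->
  (forall x, V x -> q x * h x ^+ m.+1 = \sum_(k < m.+1) a k x * h x ^+ k) ->
  forall j, exists u : nat -> X -> R,
    (forall k, poly_deg G (j * e)%N (u k)) /\
    forall x, V x -> q x ^+ j * h x ^+ j = \sum_(k < m.+1) u k x * h x ^+ k.
Proof.
move=> Gq Ga rel; elim=> [|j [u [Gu uE]]].
  exists (fun k _ => (k == 0%N)%:R); split=> [k|x Vx]; first exact: poly_deg_cst.
  rewrite big_ord_recl /= big1 ?addr0 ?mul1r ?expr0 ?mulr1// => i _.
  by rewrite mul0r.
exists (fun k x => (if k is k'.+1 then q x * u k' x else 0) + a k x * u m x).
split=> [k|x Vx].
  apply: poly_deg_add; last by rewrite mulSn; exact: poly_deg_mul.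
  by case: k => [|k]; [exact: poly_deg_cst | rewrite mulSn; exact: poly_deg_mul].
rewrite exprS exprS mulrACA uE// [RHS](eq_bigr (fun k : 'I_m.+1 =>
  (if (k : nat) is k'.+1 then q x * u k' x else 0) * h x ^+ k +
  u m x * (a k x * h x ^+ k))); last first.
  by move=> k _; rewrite mulrDl [a k x * _]mulrC mulrA.
rewrite big_split/= -big_distrr/= -rel// [X in _ = X + _]big_ord_recl mul0r add0r.
rewrite big_ord_recr /= mulrDr; congr (_ + _).
  by rewrite big_distrr; apply: eq_bigr => k _ /=; rewrite exprS; ring.
by rewrite exprS; ring.
Qed.

(** After multiplication by [q x ^+ D] only exponents of [h] up to [m] remain, with coefficients of
    degree at most [D + D * e]. As [(D + D * e).+1 <= e.+1 * D.+1], only the constant grows. *)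
Lemma growth_alg V G h q m (a : nat -> X -> R) e r :
  poly_deg G e q -> (forall k, poly_deg G e (a k)) ->
  (forall x, V x -> q x != 0) ->
  (forall x, V x -> q x * h x ^+ m.+1 = \sum_(k < m.+1) a k x * h x ^+ k) ->
  growth V G r -> growth V (h |` G) r.
Proof.
move=> Gq Ga q0 rel [K gr]; exists (m.+1 * K * e.+1 ^ r)%N => D.
have [I [b [cI bP]]] := gr (D + D * e)%N.
exists ('I_m.+1 * I)%type, 
  (fun (ki : 'I_m.+1 * I) x => b ki.2 x * h x ^+ ki.1 / q x ^+ D).
split.
  rewrite card_prod card_ord -!mulnA leq_mul2l /= (leq_trans cI)//.
  rewrite leq_mul2l -expnMn; apply/orP; right.
  by case: (r) => [//|r']; rewrite leq_exp2r//; lia.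
move=> f /poly_deg_decomp[p [sp Gp fE]].
have /choice[u uE] := reduce_power Gq Ga rel.
(* This is the coefficient of [h x ^+ k] in [q x ^+ D * f x]: each power [h x ^+ j] uses up the
   factor [q x ^+ j]. *)
pose s k x := \sum_(j < D.+1) (p x)`_j * (q x ^+ (D - j) * u j k x).
have Gs k : poly_deg G (D + D * e)%N (s k).
  apply: poly_deg_sum => j; apply: poly_deg_mul => //.
  have jD : (j <= D)%N by rewrite -ltnS.
  rewrite -[D in (D * e)%N](subnK jD) mulnDl.
  by apply: poly_deg_mul; [exact: poly_deg_exp | exact: (uE j).1].
have /choice[c cE] k := bP _ (Gs k).
exists (fun ki : 'I_m.+1 * I => c ki.1 ki.2) => x Vx; have qD : q x ^+ D != 0.
  by rewrite expf_neq0 ?q0.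
apply: (mulfI qD); rewrite -(pair_bigA _ (fun k i =>
  c (nat_of_ord k) i * (b i x * h x ^+ k / q x ^+ D))) /= big_distrr/=.
transitivity (\sum_(k < m.+1) s k x * h x ^+ k); last first.
  apply: eq_bigr => k _; rewrite cE// big_distrl big_distrr/=.
  by apply: eq_bigr => i _; rewrite [RHS]mulrC -!mulrA (mulVf qD) mulr1.
rewrite fE (horner_coef_wide _ (sp x)) big_distrr/=.
under [RHS]eq_bigr do rewrite big_distrl/=.
rewrite exchange_big; apply: eq_bigr => j _ /=.
have jD : (j <= D)%N by rewrite -ltnS.
under [RHS]eq_bigr do rewrite -!mulrA.
rewrite -!big_distrr /= -(uE j).2// -{1}(subnK jD) exprD; ring.
Qed.

Definition is_frac V G f :=
  exists e q a, [/\ poly_deg G e q, poly_deg G e a,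
    forall x, V x -> q x != 0 & forall x, V x -> q x * f x = a x].

(** A fraction satisfies a relation of degree one, the case [m = 0] of [growth_alg]. *)
Lemma growth_frac V G f r : is_frac V G f -> growth V G r -> growth V (f |` G) r.
Proof.
move=> [e [q [a [Gq Ga q0 fE]]]].
apply: (@growth_alg _ _ _ q 0 (fun=> a)) Gq _ q0 _ => // x Vx.
by rewrite big_ord1 expr1 mulr1 fE.
Qed.

Lemma is_frac_sub V G H f : G `<=` H -> is_frac V G f -> is_frac V H f.
Proof.
move=> GH [e [q [a [Gq Ga q0 fE]]]].
by exists e, q, a; split=> //; exact: poly_deg_sub GH _.
Qed.

Lemma is_frac_poly V G n f : poly_deg G n f -> is_frac V G f.
Proof.
move=> Gf; exists n, (fun=> 1), f; split=> [||x _|x _] //.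
- exact: poly_deg_cst.
- exact: oner_neq0.
- exact: mul1r.
Qed.

Lemma is_frac_cst V G c : is_frac V G (fun=> c).
Proof. exact: (is_frac_poly _ (poly_deg_cst _ 0 _)). Qed.

Lemma is_frac_gen V G f : G f -> is_frac V G f.
Proof. by move=> Gf; apply: (is_frac_poly _ (poly_deg_gen 0 Gf)). Qed.

Lemma is_frac_eq V G f h :
  (forall x, V x -> f x = h x) -> is_frac V G f -> is_frac V G h.
Proof.
move=> fh [e [q [a [Gq Ga q0 fE]]]]; exists e, q, a; split=> // x Vx.
by rewrite -fh ?fE.
Qed.

Lemma is_frac_add V G f h :
  is_frac V G f -> is_frac V G h -> is_frac V G (fun x => f x + h x).
Proof.
move=> [e [q [a [Gq Ga q0 fE]]]] [d [p [b [Gp Gb p0 hE]]]].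
exists (e + d)%N, (fun x => q x * p x), (fun x => a x * p x + q x * b x).
split=> [||x Vx|x Vx].
- exact: poly_deg_mul.
- by apply: poly_deg_add; exact: poly_deg_mul.
- by rewrite mulf_neq0 ?q0 ?p0.
- by rewrite -fE// -hE//; ring.
Qed.

Lemma is_frac_mul V G f h :
  is_frac V G f -> is_frac V G h -> is_frac V G (fun x => f x * h x).
Proof.
move=> [e [q [a [Gq Ga q0 fE]]]] [d [p [b [Gp Gb p0 hE]]]].
exists (e + d)%N, (fun x => q x * p x), (fun x => a x * b x).
split=> [||x Vx|x Vx].
- exact: poly_deg_mul.
- exact: poly_deg_mul.
- by rewrite mulf_neq0 ?q0 ?p0.
- by rewrite -fE// -hE//; ring.
Qed.

Lemma is_frac_inv V G f :
  (forall x, V x -> f x != 0) -> is_frac V G f ->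
  is_frac V G (fun x => (f x)^-1).
Proof.
move=> f0 [e [q [a [Gq Ga q0 fE]]]]; exists e, a, q; split=> // x Vx.
  by rewrite -fE// mulf_neq0 ?q0 ?f0.
by rewrite -fE// mulfK ?f0.
Qed.

Lemma is_frac_sum V G (I : Type) (s : seq I) (P : pred I) (F : I -> X -> R) :
  (forall i, P i -> is_frac V G (F i)) ->
  is_frac V G (fun x => \sum_(i <- s | P i) F i x).
Proof.
move=> GF; elim: s => [|i s IHs].
  by apply: is_frac_eq (is_frac_cst _ _ 0) => x _; rewrite big_nil.
case Pi: (P i); last by apply: is_frac_eq IHs => x _; rewrite big_cons Pi.
apply: is_frac_eq (is_frac_add (GF _ Pi) IHs) => x _.
by rewrite big_cons Pi.
Qed.

Lemma is_frac_prod V G (I : Type) (s : seq I) (P : pred I) (F : I -> X -> R) :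
  (forall i, P i -> is_frac V G (F i)) ->
  is_frac V G (fun x => \prod_(i <- s | P i) F i x).
Proof.
move=> GF; elim: s => [|i s IHs].
  by apply: is_frac_eq (is_frac_cst _ _ 1) => x _; rewrite big_nil.
case Pi: (P i); last by apply: is_frac_eq IHs => x _; rewrite big_cons Pi.
apply: is_frac_eq (is_frac_mul (GF _ Pi) IHs) => x _.
by rewrite big_cons Pi.
Qed.

Lemma is_frac_det V G n (A : X -> 'M[R]_n) :
  (forall i j, is_frac V G (fun x => A x i j)) ->
  is_frac V G (fun x => \det (A x)).
Proof.
move=> GA; apply: is_frac_sum => s _; apply: is_frac_mul; first exact: is_frac_cst.
by apply: is_frac_prod => i _.
Qed.

Lemma is_frac_adj V G n (A : X -> 'M[R]_n) :
  (forall i j, is_frac V G (fun x => A x i j)) ->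
  forall i j, is_frac V G (fun x => (\adj (A x)) i j).
Proof.
move=> GA i j; under eq_fun do rewrite mxE.
apply: is_frac_mul; first exact: is_frac_cst.
by apply: is_frac_det => k l; under eq_fun do rewrite !mxE.
Qed.

Lemma is_frac_cramer V G k (A : X -> 'M[R]_k) (z b : X -> 'cV[R]_k) :
  (forall i j, is_frac V G (fun x => A x i j)) ->
  (forall i, is_frac V G (fun x => b x i 0)) ->
  (forall x, V x -> \det (A x) != 0) ->
  (forall x, V x -> A x *m z x = b x) ->
  forall i, is_frac V G (fun x => z x i 0).
Proof.
move=> GA Gb detA AzE i.
apply: (@is_frac_eq _ _ (fun x =>
    (\det (A x))^-1 * \sum_j (\adj (A x)) i j * b x j 0)) => [x Vx|].
  apply: (mulfI (detA x Vx)); rewrite mulVKf ?detA// -AzE//.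
  have /matrixP/(_ i 0) := mulmxA (\adj (A x)) (A x) (z x).
  by rewrite mul_adj_mx mul_scalar_mx !mxE.
apply: is_frac_mul; first by apply: is_frac_inv => //; exact: is_frac_det.
apply: is_frac_sum => j _; apply: is_frac_mul => //.
exact: is_frac_adj.
Qed.

End Growth.

(** * Iterated polynomials and algebraic dependence *)

Section IteratedPoly.
Variable R : fieldType.

(** Nesting gives each nonzero polynomial a leading coefficient in one variable fewer, on which the
    inductions and eliminations rest. *)
Fixpoint iter_poly (k : nat) : idomainType :=
  if k is k'.+1 then {poly (iter_poly k')} : idomainType else R : idomainType.

Section Eval.
Variables (A : comNzRingType) (iota : {rmorphism R -> A}).

(* The outermost variable is evaluated at [y 0]. *)
Fixpoint iter_eval k : (nat -> A) -> {rmorphism iter_poly k -> A} :=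
  match k return (nat -> A) -> {rmorphism iter_poly k -> A} with
  | 0 => fun=> iota
  | k'.+1 => fun y => horner_eval (y 0%N) \o map_poly (iter_eval k' (y \o succn))
  end.

Lemma iter_evalS k (p : iter_poly k.+1) y :
  iter_eval k.+1 y p = (map_poly (iter_eval k (y \o succn)) p).[y 0%N].
Proof. by []. Qed.

Lemma iter_eval_coef k (p : {poly iter_poly k}) y :
  iter_eval k.+1 y p =
  \sum_(i < size p) iter_eval k (y \o succn) p`_i * y 0%N ^+ i.
Proof.
rewrite iter_evalS (horner_coef_wide _ (size_poly _ _)).
by apply: eq_bigr => i _; rewrite coef_map.
Qed.

End Eval.

Fixpoint iter_var k (i : nat) : iter_poly k :=
  match k return iter_poly k with
  | 0 => 0
  | k'.+1 => if i is i'.+1 then (iter_var k' i')%:P else 'X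
  end.

Lemma iter_eval_var (A : comNzRingType) (iota : {rmorphism R -> A}) k i y :
  (i < k)%N -> iter_eval iota k y (iter_var k i) = y i.
Proof.
elim: k i y => [//|k IHk] [|i] y ik.
  by rewrite iter_evalS /= map_polyX hornerX.
by rewrite iter_evalS /= map_polyC hornerC /= IHk.
Qed.

Lemma rmorph_iter_eval (A B : comNzRingType) (iota : {rmorphism R -> A})
    (f : {rmorphism A -> B}) k y (p : iter_poly k) :
  f (iter_eval iota k y p) = iter_eval (f \o iota) k (f \o y) p.
Proof.
elim: k y p => [//|k IHk] y p.
rewrite !iter_eval_coef rmorph_sum; apply: eq_bigr => i _.
by rewrite rmorphM rmorphXn IHk.
Qed.

End IteratedPoly.

Lemma eq_iter_eval (R : fieldType) (A : comNzRingType)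
    (iota iota' : {rmorphism R -> A}) (k : nat) y y' (p : iter_poly R k) :
  iota =1 iota' -> (forall i, (i < k)%N -> y i = y' i) ->
  iter_eval iota k y p = iter_eval iota' k y' p.
Proof.
move=> eq_iota; elim: k y y' p => [|k IHk] y y' p eq_y; first exact: eq_iota.
rewrite !iter_eval_coef eq_y//; apply: eq_bigr => i _.
by rewrite (IHk _ (y' \o succn))// => j jk; exact: eq_y.
Qed.

Notation iter_eval_id := (iter_eval idfun).

(** By induction the leading coefficient is nonzero at some point; the univariate polynomial left
    there has finitely many roots and so misses some natural number. *)
Lemma iter_poly_nonroot (R : numFieldType) (k : nat) (p : iter_poly R k) :
  p != 0 -> exists y, iter_eval_id k y p != 0.
Proof.
elim: k p => [|k IHk] p p0; first by exists (fun=> 0).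
have [y cy] : exists y, iter_eval_id k y (lead_coef p) != 0.
  by apply: IHk; rewrite lead_coef_eq0.
set q := map_poly (iter_eval_id k y) p.
have q0 : q != 0.
  apply: contraNneq cy => q0; have := congr1 (fun r : {poly R} => r`_(size (p : {poly _})).-1) q0.
  by rewrite coef_map coef0 => /eqP.
have [n nq] : exists n : nat, ~~ root q n%:R.
  apply/not_existsP => qn.
  have /(max_poly_roots q0) : all (root q) [seq n%:R | n <- iota 0 (size q)].
    by apply/allP => _ /mapP[n _ ->]; apply/negPn/negP => /(qn n).
  rewrite map_inj_uniq ?iota_uniq; last by move=> m n /eqP; rewrite eqr_nat => /eqP.
  by rewrite size_map size_iota ltnn => /(_ isT).
exists (fun i => if i is i'.+1 then y i' else n%:R).
by rewrite iter_evalS.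
Qed.

(** * Counting monomials *)

Section Count.
Variable R : fieldType.

(** Bounding the exponents one by one, not in total, makes the number of monomials exactly
    [D.+1 ^ k]. *)
Fixpoint exponents (D k : nat) : finType :=
  if k is k'.+1 then ('I_D.+1 * exponents D k')%type : finType
  else unit : finType.

Lemma card_exponents D k : #|exponents D k| = (D.+1 ^ k)%N.
Proof.
by elim: k => [|k IHk]; rewrite ?card_unit//= card_prod card_ord IHk expnS.
Qed.

Fixpoint imonom D k : exponents D k -> (nat -> R) -> R :=
  match k return exponents D k -> (nat -> R) -> R with
  | 0 => fun _ _ => 1
  | k'.+1 => fun s y => y 0%N ^+ s.1 * imonom s.2 (y \o succn)
  end.

Fixpoint iter_poly_of_coef D k : (exponents D k -> R) -> iter_poly R k :=
  match k return (exponents D k -> R) -> iter_poly R k with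
  | 0 => fun c => c tt
  | k'.+1 => fun c =>
      \poly_(i < D.+1) iter_poly_of_coef (fun s => c (inord i, s))
  end.

Lemma iter_eval_of_coef D k (c : exponents D k -> R) y :
  iter_eval_id k y (iter_poly_of_coef c) = \sum_s c s * imonom s y.
Proof.
elim: k c y => [|k IHk] c y.
  by rewrite (big_pred1 (tt : exponents D 0)) ?mulr1//; case.
rewrite iter_evalS (horner_coef_wide (n := D.+1)); last first.
  by rewrite (leq_trans (size_poly _ _))// size_poly.
transitivity (\sum_(i < D.+1) \sum_(s : exponents D k)
    c (i, s) * (y 0%N ^+ i * imonom s (y \o succn))); last first.
  by rewrite pair_bigA; apply: eq_bigr => -[].
apply: eq_bigr => i _.
rewrite coef_map coef_poly ltn_ord inord_val [X in X * _]IHk big_distrl/=.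
by apply: eq_bigr => s _; ring.
Qed.

Lemma iter_poly_of_coef_neq0 D k (c : exponents D k -> R) s :
  c s != 0 -> iter_poly_of_coef c != 0.
Proof.
elim: k c s => [|k IHk] c s; first by case: s.
case: s => i s cs.
have /(IHk (fun s => c (i, s))) := cs; apply: contraNneq => /= p0.
have := congr1 (fun r : {poly iter_poly R k} => r`_i) p0.
by rewrite coef_poly ltn_ord inord_val coef0 => ->.
Qed.

Lemma poly_deg_imonom (X : Type) (G : set (X -> R)) D k (s : exponents D k)
    (y : nat -> X -> R) :
  (forall i, (i < k)%N -> G (y i)) ->
  poly_deg G (k * D)%N (fun x => imonom s (y ^~ x)).
Proof.
elim: k s y => [|k IHk] s y Gy; first exact: poly_deg_cst.
rewrite mulSn; apply: poly_deg_mul; last first.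
  by apply: (IHk s.2 (y \o succn)) => i ik; exact: Gy.
apply: (@poly_deg_le _ _ _ s.1); first by rewrite -ltnS.
by rewrite -[X in poly_deg _ X _]muln1; apply: poly_deg_exp;
  apply: poly_deg_gen; exact: Gy.
Qed.

Lemma poly_deg_iter_eval (X : Type) (G : set (X -> R)) k (y : nat -> X -> R)
    (p : iter_poly R k) :
  (forall i, (i < k)%N -> G (y i)) ->
  exists e, poly_deg G e (fun x => iter_eval_id k (y ^~ x) p).
Proof.
elim: k y p => [|k IHk] y p Gy; first by exists 0%N; exact: poly_deg_cst.
have /choice[e eP] i : exists e, poly_deg G e
    (fun x => iter_eval_id k ((y ^~ x) \o succn) (p : {poly iter_poly R k})`_i).
  by apply: (IHk (y \o succn)) => j jk; exact: Gy.
pose n := size (p : {poly iter_poly R k}).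
exists (\max_(i < n) (e i + i * 1))%N.
rewrite (_ : (fun x => _) = fun x => \sum_(i < n)
    iter_eval_id k ((y ^~ x) \o succn) (p : {poly iter_poly R k})`_i *
    y 0%N x ^+ i); last by apply: funext => x; exact: iter_eval_coef.
apply: poly_deg_sum => i.
apply: (@poly_deg_le _ _ _ (e i + i * 1)%N).
  exact: (leq_bigmax (F := fun i : 'I_n => (e i + i * 1)%N)).
apply: poly_deg_mul => //.
by apply: poly_deg_exp; apply: poly_deg_gen; exact: Gy.
Qed.

(* Counting monomials of bounded degree: the functions [y 0, ..., y r] have
   [D.+1 ^ r.+1] monomials in a space of dimension [O(D ^ r)]. *)
Lemma growth_dependent (X : Type) V (G : set (X -> R)) r (y : nat -> X -> R) :
  growth V G r -> (forall i, (i < r.+1)%N -> G (y i)) ->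
  exists2 p : iter_poly R r.+1, p != 0 &
    forall x, V x -> iter_eval_id r.+1 (y ^~ x) p = 0.
Proof.
(* This [D] makes the monomials outnumber the spanning functions: [K * (r.+1 * D).+1 ^ r <= D * D.+1
   ^ r < D.+1 ^ r.+1]. *)
move=> [K gr] Gy; pose D := (K * r.+2 ^ r)%N.
have [I [b [cI bP]]] := gr (r.+1 * D)%N.
pose T := exponents D r.+1.
have IT : (#|I| < #|T|)%N.
  rewrite card_exponents (leq_ltn_trans cI)// expnS.
  apply: (@leq_ltn_trans (D * D.+1 ^ r)%N); last first.
    by rewrite ltn_pmul2r// expn_gt0.
  rewrite -mulnA leq_mul2l -expnMn; apply/orP; right.
  by case: (r) => [//|r']; rewrite leq_exp2r//; lia.
have /choice[c cE] (s : T) := bP _ (poly_deg_imonom s Gy).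
(* Rows express monomials in the spanning functions. With more rows than columns, the left kernel
   contains the coefficients of a nontrivial relation. *)
pose A : 'M[R]_(#|T|, #|I|) := \matrix_(i, j) c (enum_val i) (enum_val j).
have kerA : kermx A != 0.
  rewrite -mxrank_eq0 mxrank_ker subn_eq0 -ltnNge.
  by rewrite (leq_ltn_trans (rank_leq_col A)).
have [v vA v0] : exists2 v : 'rV[R]_#|T|, v *m A = 0 & v != 0.
  by have /rowV0Pn[v vk v0] := kerA; exists v => //; exact/sub_kermxP.
have [i vi] : exists i, v 0 i != 0 by exact/rV0Pn.
exists (iter_poly_of_coef (fun s : T => v 0 (enum_rank s))).
  by apply: (@iter_poly_of_coef_neq0 _ _ _ (enum_val i)); rewrite enum_valK.
move=> x Vx; rewrite iter_eval_of_coef.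
under eq_bigr do rewrite cE// big_distrr/=.
rewrite exchange_big big1// => j _ /=.
under eq_bigr do rewrite mulrA; rewrite -big_distrl/=.
suff -> : \sum_(s : T) v 0 (enum_rank s) * c s j = 0 by rewrite mul0r.
transitivity ((v *m A) 0 (enum_rank j)); last by rewrite vA mxE.
rewrite mxE [RHS](reindex (@enum_rank T)) /=; last first.
  by apply: onW_bij; exact: enum_rank_bij.
by apply: eq_bigr => s _; rewrite mxE !enum_rankK.
Qed.

End Count.

(** * Algebraic dependence and transcendence bases *)

Section Dependence.
Variables (R : fieldType) (X : Type).
Implicit Types (V W : set X) (y : nat -> X -> R).

(** Sets on which [y] is dependent count as small: subsets and unions of two small sets are small,
    so a large set stays large when a small part is removed. *)
Definition dependent V k y :=
  exists2 p : iter_poly R k, p != 0 &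
    forall x, V x -> iter_eval_id k (y ^~ x) p = 0.

Lemma dependent_sub V W k y : W `<=` V -> dependent V k y -> dependent W k y.
Proof. by move=> WV [p p0 pV]; exists p => // x /WV; exact: pV. Qed.

Lemma dependentU V W k y :
  dependent V k y -> dependent W k y -> dependent (V `|` W) k y.
Proof.
move=> [p p0 pV] [q q0 qW]; exists (p * q); first by rewrite mulf_neq0.
by move=> x [/pV|/qW] e; rewrite rmorphM /= e ?mul0r ?mulr0.
Qed.

Lemma dependent0 k y : dependent set0 k y.
Proof. by exists 1; [exact: oner_neq0|]. Qed.

Lemma dependent_split V W k y :
  ~ dependent V k y -> dependent (V `&` W) k y -> ~ dependent (V `\` W) k y.
Proof.
move=> nV VW VnW; apply: nV; apply: dependent_sub (dependentU VW VnW) => x Vx.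
by case: (pselect (W x)); [left|right].
Qed.

Variables (T : eqType) (i0 : T) (t : T -> X -> R) (k : nat) (y : nat -> X -> R).

Definition coords (I : seq T) (j : nat) (x : X) := t (nth i0 I j) x.

(* [W] is still large, and on it [I] is a transcendence basis of [s]; by the last
   clause the independence of [I] persists on every large subset of [W]. *)
Lemma transcendence_basis V (s : seq T) :
  ~ dependent V k y ->
  exists W I, [/\ W `<=` V, ~ dependent W k y, subseq I s,
    growth W [set t i | i in [set` s]] (size I) &
    forall p : iter_poly R (size I), p != 0 ->
      dependent (W `&` [set x | iter_eval_id (size I) (coords I ^~ x) p = 0])
        k y].
Proof.
move=> nV; elim: s => [|i s [W [I [WV nW sI gW hI]]]].
  exists V, [::]; split=> // [|p p0].
    by apply: growth_subset (@growth0 R X V) => // f [].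
  apply: dependent_sub (dependent0 k y) => x [_ /eqP] /=.
  by rewrite (negbTE p0).
have coordsS x : (coords (i :: I) ^~ x) \o succn = coords I ^~ x by [].
have sE : [set t j | j in [set` i :: s]] = t i |` [set t j | j in [set` s]].
  apply/seteqP; split=> [_ [j js <-]|f [->|[j js <-]]].
  - have /predU1P[->|js'] : (j == i) || (j \in s) by rewrite -in_cons.
      by left.
    by right; exists j.
  - by exists i => //; exact: mem_head.
  - by exists j => //; apply: (@mem_behead _ (i :: s)) js.
(* If [t i] satisfies a relation over [I] on some large subset, it becomes algebraic and the basis
   stays; otherwise [i] joins the basis. *)
have [[U [UW nU [p p0 pU]]]|ind] := pselect (exists U, [/\ U `<=` W,
  ~ dependent U k y & dependent U (size I).+1 (coords (i :: I))]); last first.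
  exists W, (i :: I); split=> [||||q q0]; [by []|by []|by rewrite /= eqxx| |].
    by rewrite sE; exact: growth_free.
  apply: contrapT => nq; apply: ind.
  by eexists; split; [|exact: nq|exists q => //]; move=> x [].
set c := lead_coef (p : {poly _}).
have c0 : c != 0 by rewrite lead_coef_eq0.
(* Where the leading coefficient vanishes, [t i] may fail to be algebraic. This set is small by [hI]
   and is removed. *)
set Z := [set x | iter_eval_id (size I) (coords I ^~ x) c = 0].
have nUZ : ~ dependent (U `\` Z) k y.
  apply: dependent_split nU _; apply: dependent_sub (hI _ c0).
  by move=> x [/UW].
exists (U `\` Z), I; split=> //.
- by move=> x [/UW/WV].
- exact: subseq_trans sI (subseq_cons _ _).
- rewrite sE; case np : (size (p : {poly _})) => [|[|m]].
  + by move/eqP: np; rewrite size_poly_eq0 (negbTE p0).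
  (* A relation free of [t i] would make [c] vanish on all of [U], leaving nothing outside [Z],
     against [nUZ]. *)
  + have pc : p = (c%:P : {poly _}).
      by rewrite /c lead_coefE np; apply: size1_polyC; rewrite np.
    case: nUZ; apply: dependent_sub (dependent0 k y) => x [/pU] + /=.
    by rewrite iter_evalS pc map_polyC hornerC coordsS.
  have gs j : (j < size I)%N -> [set t i | i in [set` s]] (coords I j).
    by move=> jI; exists (nth i0 I j) => //=; apply: (mem_subseq sI); exact: mem_nth.
  have /choice[e eP] j := poly_deg_iter_eval (p : {poly _})`_j gs.
  have le_e j : (j < m.+2)%N -> (e j <= \max_(l < m.+2) e l)%N.
    move=> jm; exact: (leq_bigmax (F := fun l : 'I_m.+2 => e l) (Ordinal jm)).
  have cE : c = (p : {poly _})`_m.+1 by rewrite /c lead_coefE np.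
  apply: (@growth_alg _ _ _ _ _ (fun x => iter_eval_id (size I) (coords I ^~ x) c)
    m (fun j x => if (j < m.+1)%N
         then - 1 * iter_eval_id (size I) (coords I ^~ x) (p : {poly _})`_j
         else 0) (\max_(l < m.+2) e l)).
  + by rewrite cE; apply: poly_deg_le (eP _); exact: le_e.
  + move=> j; case jm: (j < m.+1)%N; last exact: poly_deg_cst.
    apply: (@poly_deg_mul _ _ _ 0); first exact: poly_deg_cst.
    by apply: poly_deg_le (eP j); apply: le_e; rewrite ltnW.
  + by move=> x [_ Zx]; apply/eqP.
  + move=> x [/pU + _]; rewrite iter_eval_coef coordsS np big_ord_recr /=.
    rewrite -cE => /eqP; rewrite addrC addr_eq0 => /eqP ->.
    rewrite -sumrN; apply: eq_bigr => j _.
    by rewrite ltn_ord mulN1r mulNr.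
  + by apply: growth_subset gW => // x [/UW].
- move=> q /hI; apply: dependent_sub => x [[/UW Wx _] qx].
  by split.
Qed.

End Dependence.

(** * The reduced linear system *)

(* The minors of the linear system, cleared of denominators. *)
Definition minor_numer (S : comNzRingType) k (y : nat -> S) : 'M[S]_k :=
  \matrix_(i, j) if i == j then 0 else
    (1 + y i * y j *+ 2 - y i ^+ 2) * 
    \prod_(l < k) (if (l == i) || (l == j) then 1 else y l - y i).

Lemma map_minor_numer (S S' : comNzRingType) (f : {rmorphism S -> S'}) k y :
  map_mx f (minor_numer k y) = minor_numer k (f \o y).
Proof.
apply/matrixP => i j; rewrite !mxE; case: eqP => _; first by rewrite rmorph0.
rewrite rmorphM rmorph_prod rmorphB rmorphD rmorphMn rmorphM rmorphXn rmorph1.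
congr (_ * _); apply: eq_bigr => l _; case: ifP => _; first by rewrite rmorph1.
by rewrite rmorphB.
Qed.

Lemma eq_minor_numer (S : comNzRingType) k (y y' : nat -> S) :
  (forall i, (i < k)%N -> y i = y' i) -> minor_numer k y = minor_numer k y'.
Proof.
move=> eq_y; apply/matrixP => i j; rewrite !mxE !eq_y//.
by congr (if _ then _ else _ * _); apply: eq_bigr => l _; rewrite !eq_y.
Qed.

Lemma expand_det_row0 (S : comNzRingType) k (A : 'M[S]_k.+1) :
  \det A = \sum_(j < k.+1) A 0 j * ((-1) ^+ j * \det (row' 0 (col' j A))).
Proof.
rewrite (expand_det_row _ 0); apply: eq_bigr => j _.
by rewrite /cofactor add0n.
Qed.

(** The sample points [-2, -1, 0, 1], cut to length [k], certify that these determinants are nonzero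
    polynomials. *)
Lemma det_minor_numer2 (R : realFieldType) :
  \det (minor_numer 2 (fun i => i%:R - 2 : R)) = - 4.
Proof.
rewrite expand_det_row0 !big_ord_recl big_ord0 !det_mx11 !mxE /=.
rewrite !(big_ord_recl, big_ord0) /= /bump /=. ring.
Qed.

Lemma det_minor_numer3 (R : realFieldType) :
  \det (minor_numer 3 (fun i => i%:R - 2 : R)) = 24.
Proof.
rewrite expand_det_row0 !big_ord_recl big_ord0 !expand_det_row0.
rewrite !big_ord_recl !big_ord0 !det_mx11 !mxE /=.
rewrite !(big_ord_recl, big_ord0) /= /bump /=; ring.
Qed.

Lemma det_minor_numer4 (R : realFieldType) :
  \det (minor_numer 4 (fun i => i%:R - 2 : R)) = - 684.
Proof.
rewrite expand_det_row0 !big_ord_recl big_ord0 !expand_det_row0.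
rewrite !big_ord_recl !big_ord0 !expand_det_row0 !big_ord_recl !big_ord0.
rewrite !det_mx11 !mxE /=.
rewrite !(big_ord_recl, big_ord0) /= /bump /=; ring.
Qed.

Section ReducedSystem.
Variable R : realFieldType.

(* Coefficients of the reduced equation of a body at [a] on the axis: [pair_coef
   a b] for a body at [b] on the axis, [mirror_coef a] for the two bodies at
   [(0, 1)] and [(0, -1)]. Note that [pair_coef a a = 0] since [0^-1 = 0]. *)
Definition pair_coef (a b : R) : R := (b - a)^-1 - (b - a) / (b ^+ 2 + 1).

Definition mirror_coef (a : R) : R :=
  a * (a ^+ 2 - 3) / (2 * (a ^+ 2 + 1)).

Lemma sqrD1_neq0 (a : R) : a ^+ 2 + 1 != 0.
Proof. by rewrite gt_eqF// ltr_wpDl// sqr_ge0. Qed.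

(** Multiplying row [i] by the differences [y l - y i] and column [j] by [y j ^+ 2 + 1] yields
    [minor_numer], so a zero determinant here would force one there. *)
Lemma det_pair_coef k (y : nat -> R) :
  (forall i j : 'I_k, y i = y j -> i = j) -> \det (minor_numer k y) != 0 ->
  \det (\matrix_(i < k, j < k) pair_coef (y i) (y j)) != 0.
Proof.
move=> y_inj; apply: contraNneq => det0.
pose r := \row_(i < k) \prod_(l < k) (if l == i then 1 else y l - y i).
pose c := \row_(j < k) (y j ^+ 2 + 1).
rewrite (_ : minor_numer k y = diag_mx r *m
  \matrix_(i < k, j < k) pair_coef (y i) (y j) *m diag_mx c).
  by rewrite !det_mulmx det0 mulr0 mul0r.
apply/matrixP => i j; rewrite mul_diag_mx mul_mx_diag !mxE.
case: eqP => [->|/eqP ij].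
  by rewrite /pair_coef !subrr invr0 mul0r subr0 mulr0 mul0r.
rewrite (bigD1 j)//= [in RHS](bigD1 j)//= eqxx orbT (negbTE (_ : j != i)) 1?eq_sym//.
rewrite (eq_bigr (fun l : 'I_k => if l == i then 1 else y l - y i)); last first.
  by move=> l /negbTE ->; rewrite orbF.
set P := \prod_(l < k | _) _.
have yij : y j - y i != 0.
  by rewrite subr_eq0; apply: contraNneq ij => /y_inj ->.
have := sqrD1_neq0 (y j); rewrite /pair_coef; move=> ?; field.
by apply/andP.
Qed.

Definition solution := (('I_4 -> R) * ('I_5 -> R))%type.

Definition position (i : 'I_4) (x : solution) : R := x.1 i.
Definition strength (j : 'I_5) (x : solution) : R := x.2 j.

Definition reduced_coef (x : solution) (i : 'I_4) (j : 'I_5) : R :=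
  if unlift ord_max j is Some l then pair_coef (x.1 i) (x.1 l)
  else mirror_coef (x.1 i).

Definition reduced_system : set solution :=
  [set x : solution | injective x.1 /\ forall i, \sum_j reduced_coef x i j * x.2 j = 0].

(* The diagonal of the system vanishes in the columns of the axis bodies, so a
   single equation is solved for the strength of the mirror pair instead. *)
Definition columns (I : seq 'I_4) : seq 'I_5 :=
  if (size I < 2)%N then nseq (size I) ord_max else map (lift ord_max) I.

Lemma uniq_columns I : uniq I -> uniq (columns I).
Proof.
rewrite /columns; case: ifP => [|_ uI]; first by case: I => [|i []].
by rewrite map_inj_uniq//; exact: lift_inj.
Qed.

Lemma size_columns I : size (columns I) = size I.
Proof. by rewrite /columns; case: ifP; rewrite ?size_nseq ?size_map. Qed.

Definition minor (I : seq 'I_4) (x : solution) : 'M[R]_(size I) :=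
  \matrix_(a, b) reduced_coef x (nth ord0 I a) (nth ord0 (columns I) b).

(** The witness is the minor cleared of denominators: [1] for no position, the numerator of
    [mirror_coef] for one (nonzero at 1), the determinant of [minor_numer] for two to four. *)
Lemma minor_generic (I : seq 'I_4) : uniq I ->
  exists2 p : iter_poly R (size I), p != 0 & forall x : solution, injective x.1 ->
    iter_eval_id (size I) (coords ord0 position I ^~ x) p != 0 ->
    \det (minor I x) != 0.
Proof.
case: I => [|i [|j I]] uI.
- exists 1; first exact: oner_neq0.
  by move=> x _ _; rewrite det_mx00 oner_neq0.
- pose v := iter_var R 1 0; exists (v ^+ 3 - v *+ 3).
    apply: contraTneq isT => /(congr1 (iter_eval_id 1 (fun=> 1))).
    rewrite rmorphB rmorphMn rmorphXn rmorph0 (iter_eval_var idfun)//.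
    by move=> /eqP; rewrite expr1n lt_eqF// subr_lt0 ltr1n.
  move=> x _; rewrite rmorphB rmorphMn rmorphXn (iter_eval_var idfun)//.
  rewrite /coords det_mx11 mxE /= /reduced_coef unlift_none /position => p0.
  have := sqrD1_neq0 (x.1 i); rewrite /mirror_coef => ?.
  rewrite mulf_neq0// ?invr_eq0 ?mulf_neq0 ?pnatr_eq0//.
    by apply: contraNneq p0 => ->; rewrite expr0n mul0rn subr0.
  apply: contraNneq p0 => e.
  by rewrite exprS -[X in _ - X]mulr_natr -mulrBr e mulr0.
set I' := i :: j :: I; set k := size I'.
have k_le4 : (k <= 4)%N.
  by have := max_card (mem I'); rewrite (card_uniqP (uI : uniq I')) card_ord.
exists (\det (minor_numer k (iter_var R k))) => [|x x_inj].
  apply: contraTneq isT => /(congr1 (iter_eval_id k (fun i => i%:R - 2))).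
  rewrite -det_map_mx map_minor_numer rmorph0.
  rewrite (eq_minor_numer (y' := fun i => i%:R - 2)); last first.
    by move=> a ak; exact: iter_eval_var.
  rewrite /k /=; case: (size I) (k_le4 : ((size I).+2 <= 4)%N) => [|[|[|//]]] _.
  - by rewrite det_minor_numer2 => /eqP; rewrite oppr_eq0 pnatr_eq0.
  - by rewrite det_minor_numer3 => /eqP; rewrite pnatr_eq0.
  - by rewrite det_minor_numer4 => /eqP; rewrite oppr_eq0 pnatr_eq0.
rewrite -det_map_mx map_minor_numer.
rewrite (eq_minor_numer (y' := fun a => x.1 (nth ord0 I' a))); last first.
  by move=> a ak; exact: iter_eval_var.
move=> /det_pair_coef detE; rewrite (_ : minor I' x = \matrix_(a < k, b < k)
    pair_coef (x.1 (nth ord0 I' a)) (x.1 (nth ord0 I' b))).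
  apply: detE => a b /x_inj/eqP; rewrite nth_uniq// => /eqP ab.
  exact: val_inj.
apply/matrixP => a b; rewrite !mxE /reduced_coef.
by rewrite (nth_map ord0)// liftK.
Qed.

End ReducedSystem.

Section GrowthSeq.
Variables (R : fieldType) (X : Type) (T : eqType) (u : T -> X -> R).
Implicit Types (V : set X) (G : set (X -> R)) (s : seq T).

Lemma image_cons_sub G i s :
  G `|` [set u j | j in [set` i :: s]] `<=` u i |` (G `|` [set u j | j in [set` s]]).
Proof.
move=> f [Gf|[j js <-]]; first by right; left.
have /predU1P[->|js'] : (j == i) || (j \in s) by rewrite -in_cons.
  by left.
by right; right; exists j.
Qed.

Lemma growth_free_seq V G r s :
  growth V G r -> growth V (G `|` [set u j | j in [set` s]]) (r + size s).
Proof.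
move=> gG; elim: s => [|i s IHs] /=.
  by rewrite addn0; apply: growth_subset gG => // f [|[]].
rewrite addnS; apply: growth_subset (growth_free (u i) IHs) => //.
exact: image_cons_sub.
Qed.

Lemma growth_frac_seq V G r s :
  (forall i, i \in s -> is_frac V G (u i)) -> growth V G r ->
  growth V (G `|` [set u j | j in [set` s]]) r.
Proof.
move=> + gG; elim: s => [|i s IHs] us.
  by apply: growth_subset gG => // f [|[]].
apply: growth_subset (growth_frac (f := u i) _ (IHs _)) => //.
- exact: image_cons_sub.
- by apply: is_frac_sub (us i (mem_head _ _)); left.
- by move=> j js; apply: us; rewrite in_cons js orbT.
Qed.

End GrowthSeq.

(** * Dimension of the solution set *)

Section Dependent.
Variable R : realFieldType.
Local Notation solution := (solution R).

(** Injectivity keeps differences of distinct positions away from zero, positivity the denominators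
    [t ^ 2 + 1]. *)
Lemma is_frac_coef (V : set solution) G i j :
  V `<=` @reduced_system R -> (forall l, G (@position R l)) ->
  is_frac V G (fun x => reduced_coef x i j).
Proof.
move=> Vred Gp.
have Ft l : is_frac V G (fun x : solution => x.1 l) by exact: is_frac_gen (Gp l).
have Fsqr l : is_frac V G (fun x : solution => (x.1 l ^+ 2 + 1)^-1).
  apply: is_frac_inv; first by move=> x _; exact: sqrD1_neq0.
  by apply: is_frac_add; [exact: is_frac_mul|exact: is_frac_cst].
rewrite /reduced_coef; case: unliftP => [l|] _.
  have Fd : is_frac V G (fun x : solution => x.1 l - x.1 i).
    apply: (@is_frac_eq _ _ _ _ (fun x : solution => x.1 l + -1 * x.1 i)).
      by move=> x _; rewrite mulN1r.
    by apply: is_frac_add => //; apply: is_frac_mul => //; exact: is_frac_cst.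
  have [->|il] := eqVneq i l.
    apply: is_frac_eq (is_frac_cst _ _ 0) => x _.
    by rewrite /pair_coef subrr invr0 mul0r subr0.
  apply: (@is_frac_eq _ _ _ _ (fun x : solution =>
    (x.1 l - x.1 i)^-1 + -1 * ((x.1 l - x.1 i) * (x.1 l ^+ 2 + 1)^-1))).
    by move=> x _; rewrite mulN1r.
  apply: is_frac_add.
    apply: is_frac_inv => // x /Vred[x_inj _].
    by rewrite subr_eq0; apply: contraNneq il => /x_inj ->.
  by apply: is_frac_mul; [exact: is_frac_cst|exact: is_frac_mul].
apply: (@is_frac_eq _ _ _ _ (fun x : solution =>
  x.1 i * (x.1 i * x.1 i + - 3) * (2^-1 * (x.1 i ^+ 2 + 1)^-1))).
  by move=> x _; rewrite /mirror_coef invfM expr2.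
apply: is_frac_mul; last by apply: is_frac_mul => //; exact: is_frac_cst.
apply: is_frac_mul => //.
by apply: is_frac_add; [exact: is_frac_mul|exact: is_frac_cst].
Qed.

Lemma reduced_system_solve (x : solution) (I : seq 'I_4) : reduced_system x ->
  uniq I ->
  minor I x *m \col_b x.2 (nth ord0 (columns I) b) =
  \col_a (- \sum_(j | j \notin columns I) reduced_coef x (nth ord0 I a) j * x.2 j).
Proof.
move=> [_ xE] uI; apply/matrixP => a b; rewrite !mxE.
apply/eqP; rewrite -addr_eq0 -[X in _ == X](xE (nth ord0 I a)).
rewrite [X in _ == X](bigID (mem (columns I))) /=; apply/eqP; congr (_ + _).
rewrite -big_uniq ?uniq_columns//= (big_nth ord0) size_columns big_mkord.
by apply: eq_bigr => c _; rewrite !mxE.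
Qed.

(* With [k] coordinates of the positions transcendental, the [k] corresponding
   equations express [k] strengths rationally through the positions and the
   remaining [5 - k] strengths: the solution set has dimension at most 5. *)
Lemma reduced_system_dependent (y : nat -> solution -> R) :
  (forall i, (i < 6)%N ->
    (exists j, y i = @position R j) \/ (exists j, y i = @strength R j)) ->
  dependent (@reduced_system R) 6 y.
Proof.
move=> yE; apply: contrapT => nV.
have [W [I [WV nW sI gW hI]]] :=
  transcendence_basis ord0 (@position R) (enum 'I_4) nV.
have uI : uniq I by rewrite (subseq_uniq sI) ?enum_uniq.
have [p p0 pP] := minor_generic R uI.
set Z := [set x | iter_eval_id (size I) (coords ord0 (@position R) I ^~ x) p = 0].
(* Points where the chosen minor may vanish form a small set. *)
have nWZ : ~ dependent (W `\` Z) 6 y by apply: dependent_split nW (hI _ p0).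
set U := W `\` Z in nWZ.
have UV : U `<=` @reduced_system R by move=> x [/WV].
set J := columns I; pose J' := [seq j <- enum 'I_5 | j \notin J].
pose G := [set (@position R) i | i in [set` enum 'I_4]]
  `|` [set @strength R j | j in [set` J']].
have Gp l : G (@position R l) by left; exists l => //; exact: mem_enum.
have gG : growth U G 5.
  (* [J] has as many entries as [I], so the basis and the remaining strengths number five
     together. *)
  suff -> : 5%N = (size I + size J')%N.
    by apply: growth_free_seq; apply: growth_subset gW => // x [].
  have uJ : uniq J by exact: uniq_columns.
  rewrite size_filter -(size_columns I) -[LHS](card_ord 5) -(cardC (mem J)).
  rewrite (card_uniqP uJ) -/J; congr (_ + _)%N.
  by rewrite cardE size_filter -enumT; apply: eq_count.
have FJ j : j \in J -> is_frac U G (@strength R j).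
  move=> jJ; have bJ : (index j J < size I)%N by rewrite -size_columns index_mem.
  apply: (@is_frac_eq _ _ _ _ (fun x : solution =>
      (\col_(b < size I) x.2 (nth ord0 J b)) (Ordinal bJ) 0)).
    by move=> x _; rewrite mxE /= nth_index.
  apply: (is_frac_cramer (A := minor I) (b := fun x => \col_a
    (- \sum_(l | l \notin J) reduced_coef x (nth ord0 I a) l * x.2 l))).
  - by move=> a b; apply: is_frac_eq (is_frac_coef _ _ UV Gp) => x _; rewrite mxE.
  - move=> a; apply: (@is_frac_eq _ _ _ _ (fun x : solution =>
      \sum_(l | l \notin J) -1 * (reduced_coef x (nth ord0 I a) l * x.2 l))).
      by move=> x _; rewrite mxE -sumrN; apply: eq_bigr => l _; rewrite mulN1r.
    apply: is_frac_sum => l lJ; apply: is_frac_mul; first exact: is_frac_cst.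
    apply: is_frac_mul; first exact: is_frac_coef.
    apply: is_frac_gen; right; exists l => //=.
    by rewrite mem_filter lJ mem_enum.
  - by move=> x Ux; apply: pP; [case: (UV x Ux)|case: Ux => _ /eqP].
  - by move=> x /UV /reduced_system_solve; exact.
(* Six functions under growth of order 5 are dependent, against the largeness of [U]. *)
apply: nWZ; apply: growth_dependent (growth_frac_seq FJ gG) _ => i /yE[[j ->]|[j ->]].
  by left.
have [jJ|jJ] := boolP (j \in J); first by right; exists j.
by left; right; exists j => //=; rewrite mem_filter jJ mem_enum.
Qed.

End Dependent.

(** Linear factors are split off one at a time, by induction on the size. *)
Lemma roots_seq (R : fieldType) (p : {poly R}) :
  p != 0 -> exists s : seq R, forall z, root p z -> z \in s.
Proof.
have [n] := ubnP (size p); elim: n p => // n IHn p pn p0.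
have [[z /factor_theorem[q pE]]|noroot] := pselect (exists z, root p z); last first.
  by exists [::] => z pz; case: noroot; exists z.
have q0 : q != 0 by apply: contraNneq p0 => q0; rewrite pE q0 mul0r.
have [|s sP] := IHn q _ q0.
  by move: pn; rewrite pE size_Mmonic ?monicXsubC// size_XsubC addn2.
exists (z :: s) => u; rewrite pE rootM root_XsubC in_cons.
by case/orP=> [/sP ->|->]; rewrite ?orbT.
Qed.

(** * The exceptional strengths *)

Section Exceptional.
Variable R : realType.

Definition strength_seq (g : 'I_5 -> R) (j : nat) : R := g (inord j).

Lemma position_finite (a : 'I_4) :
  exists2 c : iter_poly R 5, c != 0 & forall g,
    iter_eval_id 5 (strength_seq g) c != 0 ->
    exists s : seq R, forall t, reduced_system (t, g) -> t a \in s.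
Proof.
(* The position comes outermost, so the leading coefficient is a polynomial in the strengths
   alone. *)
pose y i := if i is j.+1 then @strength R (inord j) else @position R a.
have [|p p0 pP] := @reduced_system_dependent R y.
  by case=> [|i] _; [left; exists a|right; exists (inord i)].
exists (lead_coef (p : {poly _})) => [|g cg]; first by rewrite lead_coef_eq0.
pose q := map_poly (iter_eval_id 5 (strength_seq g)) (p : {poly _}).
have q0 : q != 0.
  apply: contraNneq cg => q0.
  have := congr1 (fun r : {poly R} => r`_(size (p : {poly _})).-1) q0.
  by rewrite coef_map coef0 => /eqP.
have [s sP] := roots_seq q0; exists s => t /pP pt.
by apply: sP; apply/rootP.
Qed.

Definition mpoly_of_iter (p : iter_poly R 5) : {mpoly R[5]} :=
  iter_eval (@mpolyC 5 R) 5 (fun j => 'X_(inord j)) p.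

Lemma meval_mpoly_of_iter (g : 'I_5 -> R) p :
  (mpoly_of_iter p).@[g] = iter_eval_id 5 (strength_seq g) p.
Proof.
rewrite (rmorph_iter_eval _ (meval g)); apply: eq_iter_eval => [z|i _] /=.
  by rewrite mevalC.
by rewrite mevalXU.
Qed.

(** [C] is the zero set of the product of the four leading coefficients; it is proper because a
    nonzero polynomial has a nonroot. *)
Lemma exceptional_strengths :
  exists2 C : set ('I_5 -> R), zariski_closed C /\ C `<` [set: 'I_5 -> R] &
    forall g, ~ C g -> finite_set [set t | reduced_system (t, g)].
Proof.
have /choice[c cP] a : exists c : iter_poly R 5, c != 0 /\ forall g,
    iter_eval_id 5 (strength_seq g) c != 0 ->
    exists s : seq R, forall t, reduced_system (t, g) -> t a \in s.
  by have [c c0 cP] := position_finite a; exists c.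
pose p := \prod_a c a.
have p0 : p != 0 by apply/prodf_neq0 => a _; exact: (cP a).1.
exists [set g | (mpoly_of_iter p).@[g] = 0]; first split.
- exists [set mpoly_of_iter p]; apply/seteqP; split=> [g pg _ ->//|g]; exact.
- split=> [//|/(_ _ I) /= Cg].
  have [y /eqP] := iter_poly_nonroot p0; apply.
  rewrite -[RHS](Cg (fun j => y j)) meval_mpoly_of_iter.
  by apply: eq_iter_eval => // i i5; rewrite /strength_seq inordK.
move=> g /=; rewrite meval_mpoly_of_iter rmorph_prod => /eqP pg.
have /choice[s sP] a : exists s : seq R,
    forall t, reduced_system (t, g) -> t a \in s.
  by apply: (cP a).2; move/prodf_neq0: pg; exact.
(* Nested pairs encode [t], so that finiteness follows from that of products of finite sets. *)
pose f (u : R * R * (R * R)) (a : 'I_4) : R :=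
  nth 0 [:: u.1.1; u.1.2; u.2.1; u.2.2] a.
apply: (@sub_finite_set _ _ (f @`
  (([set` s (inord 0)] `*` [set` s (inord 1)]) `*`
   ([set` s (inord 2)] `*` [set` s (inord 3)])))); last first.
  by apply: finite_image; do !apply: finite_setX.
move=> t tg; exists ((t (inord 0), t (inord 1)), (t (inord 2), t (inord 3))).
  by do !split; exact: sP.
apply: funext => -[[|[|[|[|//]]]] a4]; rewrite /f /=; congr t;
  by apply: val_inj; rewrite /= inordK.
Qed.

End Exceptional.

(** * Cross configurations *)

Section Geometry.
Variable R : realType.
Implicit Types (u v p d n c : plane R) (x y z : config R).

Lemma dotE u v : dot u v = u 0 0 * v 0 0 + u 0 1 * v 0 1.
Proof.
rewrite /dot !big_ord_recl big_ord0 addr0.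
by rewrite (_ : lift ord0 ord0 = 1)//; exact: val_inj.
Qed.

Lemma dot_ge0 u : 0 <= dot u u.
Proof. by rewrite dotE addr_ge0// -expr2 sqr_ge0. Qed.

Lemma plane_eqP u v : u 0 0 = v 0 0 -> u 0 1 = v 0 1 -> u = v.
Proof.
move=> uv0 uv1; apply/rowP => -[[|[|//]]] i2.
  by rewrite (_ : Ordinal _ = 0)//; exact: val_inj.
by rewrite (_ : Ordinal _ = 1)//; exact: val_inj.
Qed.

Lemma dot_eq0 u : (dot u u == 0) = (u == 0).
Proof.
apply/eqP/eqP => [|->]; last by rewrite dotE !mxE; ring.
move/eqP; rewrite dotE -!expr2 paddr_eq0 ?sqr_ge0// !sqrf_eq0.
by move=> /andP[/eqP u0 /eqP u1]; apply: plane_eqP; rewrite !mxE.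
Qed.

Lemma euclid_norm_invsqr u : euclid_norm u ^- 2 = (dot u u)^-1.
Proof. by rewrite /euclid_norm sqr_sqrtr// dot_ge0. Qed.

Lemma equiv_config_trans x y z :
  equiv_config x y -> equiv_config y z -> equiv_config x z.
Proof.
move=> [k [P [s [k0 [PP dP] yE]]]] [l [Q [t [l0 [QQ dQ] zE]]]].
exists (l * k), (P *m Q), (l *: (s *m Q) + t); split; first exact: mulr_gt0.
  split; last by rewrite det_mulmx dP dQ mulr1.
  by rewrite trmx_mul mulmxA -[P *m Q *m _]mulmxA QQ mulmx1 PP.
move=> i; rewrite zE yE mulmxDl -scalemxAl scalerDr scalerA mulmxA.
by rewrite addrA.
Qed.

Lemma equiv_config_sym x y : equiv_config x y -> equiv_config y x.
Proof.
move=> [k [P [s [k0 [PP dP] yE]]]].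
exists k^-1, P^T, (- (k^-1 *: (s *m P^T))); split; first by rewrite invr_gt0.
  by split; [rewrite trmxK; exact: mulmx1C|rewrite det_tr].
move=> i; rewrite yE mulmxDl -scalemxAl -mulmxA PP mulmx1 scalerDr scalerA.
by rewrite mulVf ?gt_eqF// scale1r addrK.
Qed.

Lemma equiv_config_class x y : equiv_config x y ->
  [set z | equiv_config x z] = [set z | equiv_config y z].
Proof.
move=> xy; apply/seteqP; split=> z /=; last exact: equiv_config_trans.
by apply: equiv_config_trans; exact: equiv_config_sym.
Qed.

Definition axis_body (i : 'I_4) : 'I_6 := widen_ord (isT : (4 <= 6)%N) i.
Definition upper_body : 'I_6 := Ordinal (isT : (4 < 6)%N).
Definition lower_body : 'I_6 := ord_max.

Lemma body_cases (P : 'I_6 -> Prop) :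
  (forall i, P (axis_body i)) -> P upper_body -> P lower_body -> forall i, P i.
Proof.
move=> Pa Pu Pl i; have [i4|] := ltnP i 4.
  by rewrite (_ : i = axis_body (Ordinal i4))//; exact: val_inj.
rewrite leq_eqVlt => /predU1P[i4|i4].
  by rewrite (_ : i = upper_body)//; exact: val_inj.
rewrite (_ : i = lower_body)//; apply: val_inj => /=.
by apply/eqP; rewrite eqn_leq -ltnS ltn_ord.
Qed.

Lemma big_body (F : 'I_6 -> R) : \sum_i F i =
  \sum_i F (axis_body i) + F upper_body + F lower_body.
Proof.
rewrite 2!big_ord_recr /=; congr (_ + F _ + F _); last exact: val_inj.
by apply: eq_bigr => i _; congr F; exact: val_inj.
Qed.

Lemma bump_max m (i : 'I_m) : bump m i = i.
Proof. by rewrite /bump leqNgt ltn_ord. Qed.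

Lemma extend_strengths_axis (g : 'I_5 -> R) i :
  extend_strengths g (axis_body i) = g (lift ord_max i).
Proof.
rewrite /extend_strengths; case: unliftP => [j|] /(congr1 val) /=.
  by rewrite bump_max => ij; congr g; apply: val_inj; rewrite /= bump_max.
by move=> i5; have := ltn_ord i; rewrite i5.
Qed.

Lemma extend_strengths_upper (g : 'I_5 -> R) :
  extend_strengths g upper_body = g ord_max.
Proof.
rewrite /extend_strengths; case: unliftP => [j|] /(congr1 val) //=.
by rewrite bump_max => ij; congr g; apply: val_inj.
Qed.

Lemma extend_strengths_lower (g : 'I_5 -> R) :
  extend_strengths g lower_body = g ord_max.
Proof. by rewrite /extend_strengths /lower_body unlift_none. Qed.

(* [cross c n t]: the line through [c] orthogonal to [n] carries the first four
   bodies, with abscissas [t] in the unit [n]. *)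
Definition cross c n (t : 'I_4 -> R) (i : 'I_6) : plane R :=
  if insub (val i) : option 'I_4 is Some j
  then \row_k (if k == 0 then c 0 0 + t j * n 0 1 else c 0 1 - t j * n 0 0)
  else if val i == 4 then c + n else c - n.

Lemma cross_axis c n t i : cross c n t (axis_body i) =
  \row_k (if k == 0 then c 0 0 + t i * n 0 1 else c 0 1 - t i * n 0 0).
Proof.
rewrite /cross; case: insubP => [j _ /val_inj ->//|].
by rewrite /= ltn_ord.
Qed.

Lemma cross_upper c n t : cross c n t upper_body = c + n.
Proof. by rewrite /cross; case: insubP. Qed.

Lemma cross_lower c n t : cross c n t lower_body = c - n.
Proof. by rewrite /cross; case: insubP. Qed.

Definition crossE := (cross_axis, cross_upper, cross_lower).

Definition e2 : plane R := \row_k (k == 1)%:R.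

(** Up to direct similarity a cross depends on its abscissas alone. *)
Lemma cross_equiv c n t : n != 0 -> equiv_config (cross 0 e2 t) (cross c n t).
Proof.
move=> n0; pose r := euclid_norm n.
have r_gt0 : 0 < r by rewrite sqrtr_gt0 lt_def dot_eq0 n0 dot_ge0.
have rr : r * r = n 0 0 * n 0 0 + n 0 1 * n 0 1.
  by rewrite -expr2 sqr_sqrtr ?dot_ge0// dotE.
have r_neq0 : r != 0 by rewrite gt_eqF.
(* The rotation taking [e2] to the direction of [n]. *)
pose Q : 'M[R]_2 := \matrix_(i, j)
  (if i == 0 then if j == 0 then n 0 1 / r else - n 0 0 / r
   else if j == 0 then n 0 0 / r else n 0 1 / r).
have uQ (u : plane R) : u *m Q = \row_k (if k == 0
    then (u 0 0 * n 0 1 + u 0 1 * n 0 0) / r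
    else (u 0 1 * n 0 1 - u 0 0 * n 0 0) / r).
  apply: plane_eqP; rewrite !mxE !big_ord_recl big_ord0 !mxE /=;
  by rewrite (_ : lift ord0 ord0 = 1) ?ord1//; [ring|exact: val_inj].
exists r, Q, c; split=> //.
  split.
    apply/matrixP => -[[|[|//]] i2] [[|[|//]] j2];
    rewrite !mxE !big_ord_recl big_ord0 !mxE /= addr0;
    apply: (mulfI (mulf_neq0 r_neq0 r_neq0)).
    - by rewrite mulr1 [RHS]rr; field.
    - by field.
    - by field.
    - by rewrite mulr1 [RHS]rr; field.
  rewrite (expand_det_row _ 0) !big_ord_recl big_ord0 /cofactor !det_mx11 !mxE /=.
  rewrite /bump /=; apply: (mulfI (mulf_neq0 r_neq0 r_neq0)).
  by rewrite mulr1 [RHS]rr; field.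
apply: body_cases => [i||]; rewrite !crossE uQ; apply: plane_eqP; rewrite !mxE /=;
  by field.
Qed.

End Geometry.

(** * From cross configurations to the reduced system *)

Section CrossConfiguration.
Variable R : realType.
Implicit Types (u v p d n c : plane R) (x : config R).

(** Take for [c] the foot of the perpendicular from the upper body to the axis and for [n] the
    offset. The mirror image [c - n] is a body off the axis other than the upper one, hence the
    lower one. *)
Lemma CC6VP_cross gamma x : CC6VP gamma x ->
  exists c n t, n != 0 /\ x = cross c n t.
Proof.
move=> [[_ _ _ _] _ [p [d [d0 refl xline]]]].
have dd : dot d d != 0 by rewrite dot_eq0.
pose s := dot (x upper_body - p) d / dot d d.
pose c := p + s *: d; pose n := x upper_body - c.
have nd : n 0 0 * d 0 0 + n 0 1 * d 0 1 = 0.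
  rewrite /n /c !mxE /s; move: dd; rewrite !dotE !mxE => dd.
  by field.
have offline (i : 'I_6) : (3 < i)%N -> ~ line p d (x i).
  by move=> i3 /xline; rewrite ltnS leqNgt i3.
have n0 : n != 0.
  apply/eqP => n0; apply: (offline upper_body) => //.
  by exists s => //; apply/esym/eqP; rewrite -subr_eq0; apply/eqP.
have reflE : reflection p d (x upper_body) = c - n.
  rewrite /reflection /n /c -/s; apply: plane_eqP; rewrite !mxE; ring.
have x_lower : x lower_body = c - n.
  have [i _ xi] : range x (c - n).
    by rewrite -refl -reflE; exists (x upper_body) => //; exists upper_body.
  have off : ~ line p d (x i).
    rewrite xi => -[r _ rE]; apply: (offline upper_body) => //.
    exists (2 * s - r) => //; apply: plane_eqP.
      have /rowP/(_ 0) := rE; rewrite /n /c !mxE => e.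
      by apply/eqP; rewrite -subr_eq0; apply/eqP; lra.
    have /rowP/(_ 1) := rE; rewrite /n /c !mxE => e.
    by apply/eqP; rewrite -subr_eq0; apply/eqP; lra.
  move: off xi; elim/body_cases: i => [i off|_ xi|_ xi].
  - by case: off; apply/xline; rewrite /= ltn_ord.
  - case/negP: n0; rewrite -dot_eq0; apply/eqP; rewrite dotE.
    have /rowP xi' : n = - n by rewrite {1}/n xi addrC addKr.
    by have := xi' 0; have := xi' 1; rewrite !mxE; nra.
  - exact: xi.
have x_upper : x upper_body = c + n by rewrite addrC subrK.
have cE k : c 0 k = p 0 k + s * d 0 k by rewrite !mxE.
clearbody n c s.
(* Since [d] is orthogonal to [n], it equals [m] over the squared length of [n], times [orth n];
   this converts parameters along [d] into abscissas. *)
pose m := n 0 1 * d 0 0 - n 0 0 * d 0 1.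
have nn : n 0 0 * n 0 0 + n 0 1 * n 0 1 != 0 by rewrite -dotE dot_eq0.
have /choice[r rE] (i : 'I_4) : exists r, p + r *: d = x (axis_body i).
  by have /xline[r _ <-] : (axis_body i < 4)%N := ltn_ord i; exists r.
exists c, n, (fun i => (r i - s) * m / (n 0 0 * n 0 0 + n 0 1 * n 0 1)); split=> //.
apply: funext; apply: body_cases => [i||]; rewrite !crossE //.
rewrite -rE; apply: plane_eqP; rewrite !mxE /= cE /m.
- apply/eqP; rewrite -subr_eq0; apply/eqP.
  transitivity (- (r i - s) * n 0 0 / (n 0 0 * n 0 0 + n 0 1 * n 0 1) * 
    - (n 0 0 * d 0 0 + n 0 1 * d 0 1)); first by field.
  by rewrite nd oppr0 mulr0.
- apply/eqP; rewrite -subr_eq0; apply/eqP.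
  transitivity ((r i - s) * n 0 1 / (n 0 0 * n 0 0 + n 0 1 * n 0 1) *
    (n 0 0 * d 0 0 + n 0 1 * d 0 1)); first by field.
  by rewrite nd mulr0.
Qed.

(** The unit of abscissas on the axis: axis body [j] of [cross c n t] lies at
    [c + t j *: orth n]. *)
Definition orth n : plane R := \row_k (if k == 0 then n 0 1 else - n 0 0).

(* The sum is unrestricted because its term [j = i] vanishes. *)
Lemma central_configuration_dot gamma x : central_configuration gamma x ->
  exists lambda : R, exists c : plane R, forall i v,
    \sum_j gamma j / dot (x i - x j) (x i - x j) * dot (x j - x i) v
      + lambda * dot (x i - c) v = 0.
Proof.
move=> [_ _ _ [lambda _ xE]]; exists lambda, (vortex_center gamma x) => i v.
move: (vortex_center gamma x) xE => c xE.
have E (k : 'I_2) : \sum_j gamma j / dot (x i - x j) (x i - x j) *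
    ((x j 0 k - x i 0 k) * v 0 k) + lambda * ((x i 0 k - c 0 k) * v 0 k) = 0.
  have /rowP/(_ k) := xE i; rewrite !mxE summxE => /(congr1 ( *%R^~ (v 0 k))).
  rewrite mul0r mulrDl big_distrl -mulrA /= => e.
  rewrite (bigD1 i)//= (subrr (x i 0 k)) mul0r mulr0 add0r.
  apply: etrans e; congr (_ + _).
  by apply: eq_bigr => j _; rewrite !mxE euclid_norm_invsqr mulrA.
have := congr2 +%R (E 0) (E 1); rewrite addr0 addrACA -big_split -mulrDr => e.
apply: etrans e; rewrite dotE !mxE.
apply: (congr2 +%R) => //; apply: eq_bigr => j _.
by rewrite /= -mulrDr [X in _ * X]dotE !mxE.
Qed.

Lemma dot0 v : dot 0 v = 0.
Proof. by rewrite dotE !mxE !mul0r addr0. Qed.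

(** The equations of the upper body give the multiplier and the component of the centre along the
    axis; substituted into the axial equations of the axis bodies, they leave the reduced system. *)
Lemma cross_reduced (g : 'I_5 -> R) c n t : n != 0 ->
  central_configuration (extend_strengths g) (cross c n t) ->
  reduced_system (t, g).
Proof.
move=> n0 cc; have [_ _ x_inj _] := cc.
have [lambda [w eqs]] := central_configuration_dot cc.
pose nu := n 0 0 ^+ 2 + n 0 1 ^+ 2.
have nu0 : nu != 0 by rewrite /nu !expr2 -dotE dot_eq0.
split=> [i j tij|i].
  have : axis_body i = axis_body j by apply: x_inj; rewrite !crossE /= in tij *; rewrite tij.
  by move/(congr1 val) => /= ij; exact: val_inj.
pose a := lambda * dot (c - w) (orth n); pose b := lambda * dot (c - w) n.
have dist_axis j k : dot (cross c n t (axis_body j) - cross c n t (axis_body k))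
    (cross c n t (axis_body j) - cross c n t (axis_body k)) = nu * (t k - t j) ^+ 2.
  by rewrite !crossE dotE !mxE /= /nu; ring.
have dist_upper j : dot (cross c n t (axis_body j) - cross c n t upper_body)
    (cross c n t (axis_body j) - cross c n t upper_body) = nu * (t j ^+ 2 + 1).
  by rewrite !crossE dotE !mxE /= /nu; ring.
have dist_lower j : dot (cross c n t (axis_body j) - cross c n t lower_body)
    (cross c n t (axis_body j) - cross c n t lower_body) = nu * (t j ^+ 2 + 1).
  by rewrite !crossE dotE !mxE /= /nu; ring.
have dist_upper' j : dot (cross c n t upper_body - cross c n t (axis_body j))
    (cross c n t upper_body - cross c n t (axis_body j)) = nu * (t j ^+ 2 + 1).
  by rewrite !crossE dotE !mxE /= /nu; ring.
(* Across the axis, the pulls of the two equal mirror bodies on an axis body cancel. *)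
have b0 : b = 0.
  have := eqs (axis_body i) n; rewrite big_body big1 ?add0r; last first.
    by move=> j _; rewrite [X in _ * X](_ : _ = 0) ?mulr0// !crossE dotE !mxE /=; ring.
  rewrite dist_upper dist_lower extend_strengths_upper extend_strengths_lower.
  by rewrite !crossE => e; rewrite -[RHS]e /b !dotE !mxE /=; ring.
have aE : a = - \sum_j g (lift ord_max j) * (t j / (t j ^+ 2 + 1)).
  have := eqs upper_body (orth n).
  rewrite big_body extend_strengths_upper extend_strengths_lower.
  rewrite subrr (dot0 (orth n)) mulr0 addr0.
  rewrite [X in _ + _ * X + _](_ : _ = 0); last by rewrite !crossE dotE !mxE /=; ring.
  rewrite mulr0 addr0 => /eqP; rewrite addrC addr_eq0 => /eqP e.
  transitivity (lambda * dot (cross c n t upper_body - w) (orth n)).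
    by rewrite /a crossE !dotE !mxE /=; ring.
  rewrite e; congr (- _); apply: eq_bigr => j _.
  rewrite dist_upper' extend_strengths_axis.
  transitivity (g (lift ord_max j) / (nu * (t j ^+ 2 + 1)) * (t j * nu)).
    by congr (_ * _); rewrite !crossE dotE !mxE /= /nu; ring.
  by have := sqrD1_neq0 (t j); move=> ?; field; apply/andP.
have lE : lambda * nu = \sum_j g (lift ord_max j) / (t j ^+ 2 + 1) + g ord_max / 2.
  have := eqs upper_body n.
  rewrite big_body extend_strengths_upper extend_strengths_lower.
  rewrite subrr (dot0 n) mulr0 addr0.
  rewrite (_ : dot (_ - _) (_ - _) = 4 * nu); last first.
    by rewrite !crossE dotE !mxE /= /nu; ring.
  rewrite [X in _ + _ * X + _](_ : _ = - 2 * nu); last first.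
    by rewrite !crossE dotE !mxE /= /nu; ring.
  move=> e; apply/eqP; rewrite -subr_eq0; apply/eqP; rewrite -[RHS]e.
  rewrite (_ : lambda * dot _ _ = b + lambda * nu); last first.
    by rewrite /b !crossE !dotE !mxE /= /nu; ring.
  rewrite b0 add0r opprD addrC -sumrN; congr (_ + _ + _); last by field.
  apply: eq_bigr => j _; rewrite dist_upper' extend_strengths_axis.
  transitivity (g (lift ord_max j) / (nu * (t j ^+ 2 + 1)) * (- nu)); last first.
    by congr (_ * _); rewrite !crossE dotE !mxE /= /nu; ring.
  by have := sqrD1_neq0 (t j); move=> ?; field; apply/andP.
have := eqs (axis_body i) (orth n).
rewrite big_body dist_upper dist_lower extend_strengths_upper extend_strengths_lower.
rewrite (_ : lambda * dot _ _ = a + lambda * nu * t i); last first.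
  by rewrite /a !crossE !dotE !mxE /= /nu; ring.
move=> e; apply: etrans e.
rewrite [LHS]big_ord_recr /= {2}/reduced_coef unlift_none /=.
have -> : mirror_coef (t i) * g ord_max = g ord_max / 2 * t i +
    (g ord_max / (nu * (t i ^+ 2 + 1)) *
       dot (cross c n t upper_body - cross c n t (axis_body i)) (orth n) +
     g ord_max / (nu * (t i ^+ 2 + 1)) *
       dot (cross c n t lower_body - cross c n t (axis_body i)) (orth n)).
  rewrite -mulrDr (_ : dot _ _ + dot _ _ = - 2 * t i * nu); last first.
    by rewrite !crossE !dotE !mxE /= /nu; ring.
  have := sqrD1_neq0 (t i); rewrite /mirror_coef => ?.
  by field; apply/andP.
rewrite (_ : \sum_(j < 4) _ * _ = \sum_j extend_strengths g (axis_body j) /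
      dot (cross c n t (axis_body i) - cross c n t (axis_body j))
        (cross c n t (axis_body i) - cross c n t (axis_body j)) *
      dot (cross c n t (axis_body j) - cross c n t (axis_body i)) (orth n) +
    (a + (\sum_j g (lift ord_max j) / (t j ^+ 2 + 1)) * t i)).
  by rewrite lE; ring.
rewrite aE -sumrN big_distrl -!big_split; apply: eq_bigr => j _ /=.
rewrite extend_strengths_axis dist_axis (_ : dot _ (orth n) = (t j - t i) * nu).
  have -> : widen_ord (leqnSn 4) j = lift ord_max j.
    by apply: val_inj; rewrite /= bump_max.
  rewrite /reduced_coef liftK /= /pair_coef.
  (* For coinciding abscissas the convention [0^-1 = 0] makes both interaction terms vanish. *)
  have [tji|tji] := eqVneq (t j - t i) 0.
    rewrite tji invr0 !mul0r subrr mul0r mulr0 add0r.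
    by move/eqP: tji; rewrite subr_eq0 => /eqP ->; rewrite mulrA; ring.
  by field; rewrite sqrD1_neq0 tji nu0.
by rewrite !crossE !dotE !mxE /= /nu; ring.
Qed.

End CrossConfiguration.

Theorem theorem8p2 (R : realType) :
  exists C : set ('I_5 -> R),
    [/\ zariski_closed C,
        C `<` [set: 'I_5 -> R] &
        forall g : 'I_5 -> R, ~ C g ->
          finite_set [set [set y | equiv_config x y] |
                       x in CC6VP (extend_strengths g)]].
Proof.
have [C [closedC properC] finC] := exceptional_strengths R.
exists C; split=> // g /finC fin_t.
(* Every class is that of the normal form [cross 0 e2 t] for one of finitely many [t]. *)
apply: sub_finite_set (finite_image
  (fun t => [set y | equiv_config (cross 0 (e2 R) t) y]) fin_t).
move=> _ [x CCx <-]; have [c [n [t [n0 xE]]]] := CC6VP_cross CCx.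
move: CCx; rewrite xE => -[cc _ _]; exists t; first exact: cross_reduced n0 cc.
exact/equiv_config_class/cross_equiv.
Qed.
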